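(* Consider a CRN having at least one conservation law with all entries strictly positive, and let $\{\mathbf x_i\}$ denote its conservation laws. Let $A=(\mathcal S_A,\mathcal R_A)$ be a MAS with core set $A_C$ such that $|\mathcal S_A|=|A_C|+1$, and let $T$ be its FWMC partition. Then the species-productive cone of $A$ equals its partition-productive cone: $\mathcal P(A)=\mathcal Q(T)$.
   Context: A chemical reaction network (CRN) consists of a finite species set $\mathcal S$ and a finite set $\mathcal R$ of reactions; each reaction $r$ is written $r^-\to r^+$ with input complex $r^-\in\mathbb Z_{\ge0}^{\mathcal S}$ and output complex $r^+\in\mathbb Z_{\ge0}^{\mathcal S}$. The input and output matrices $\mathbb S^-,\mathbb S^+$ have columns $r^-$, resp. $r^+$; the stoichiometric matrix is $\mathbb S=\mathbb S^+-\mathbb S^-$. A conservation law is a vector $\mathbf x\in\mathbb R^{\mathcal S}$ with $\mathbf x^T\mathbb S=\mathbf0$. $(\mathbb A)_M^N$ denotes the submatrix with rows in $M$ and columns in $N$. $\mathbf v\gg\mathbf 0$ means all entries $>0$; $\mathbf v>\mathbf 0$ means all entries $\ge0$ and $\mathbf v\ne\mathbf 0$. A motif $(\mathcal M,\mathcal R')$ ($\mathcal M\subseteq\mathcal S,\mathcal R'\subseteq\mathcal R$) is exclusively autocatalytic if: (i) some $\mathbf v\gg\mathbf0$ in $\mathbb R^{\mathcal R'}$ has $(\mathbb S)_{\mathcal M}^{\mathcal R'}\mathbf v\gg\mathbf 0$; (ii) every row and (iii) every column of $(\mathbb S^-)_{\mathcal M}^{\mathcal R'}$ is semi-positive. An autocatalytic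 core is an exclusively autocatalytic motif $(A_C,\mathcal R_A)$ no proper sub-motif ($\mathcal M'\subseteq A_C$, $\mathcal R''\subseteq\mathcal R_A$) of which is exclusively autocatalytic. The minimal autocatalytic subnetwork (MAS) $A=(\mathcal S_A,\mathcal R_A)$ of a core $(A_C,\mathcal R_A)$ has reaction set $\mathcal R_A$ and species set $\mathcal S_A$ consisting of all species occurring in some input or output complex of a reaction in $\mathcal R_A$; each MAS is assumed to have a unique core. Put $\overline{\mathbb S}=(\mathbb S)_{\mathcal S_A}^{\mathcal R_A}$ and $\overline{\mathbb S}_C=(\mathbb S)_{A_C}^{\mathcal R_A}$ (a square invertible matrix). The species-productive cone is $\mathcal P(A)=\{\overline{\mathbb S}\,\overline{\mathbb S}_C^{-1}\mathbf u:\mathbf u\ge\mathbf0\}\subseteq\mathbb R^{\mathcal S_A}$. FWMC partition $T=\{T_F,T_W,T_{M/C},T_C\}$ of $\mathcal S_A$: the food set $T_F$ consists of species whose row in $\overline{\mathbb S}$ has all entries $\le0$; the waste set $T_W$ those whose row has all entries $\ge0$; the member set those whose row has both positive and negative entries; $T_C=A_C$ (contained in the member set); $T_{M/C}$ = member set minus $A_C$. Partition-productive cone: with $e_i$ the standard basis vectors of $\mathbb R^{\mathcal S_A}$, let $\mathcal B_T=\{-e_f:f\in T_F\}\cup\{e_w:w\in T_W\}\cup\{-e_m,e_m:m\in T_{M/C}\}\cup\{e_c:c\in T_C\}$, and $\mathcal Q(T)=\mathrm{cone}(\mathcal B_T)\cap\{\mathbf y\in\mathbb R^{\mathcal S_A}:\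 \mathbf x_i|_{\mathcal S_A}\cdot\mathbf y=0\ \text{for all } i\}$, where $\mathbf x_i|_{\mathcal S_A}$ is the restriction of $\mathbf x_i$ to the coordinates in $\mathcal S_A$. *)

(* Defs.v *)
(* A CRN is given by finite types of species S and reactions Rx,
   and input/output matrices Sm (= S^-) and Sp (= S^+) with nat entries.
   Vectors in R^X are functions X -> R; vectors in R^{S_A} are represented by
   functions S -> R vanishing outside S_A. *)
From mathcomp Require Import all_boot all_order all_algebra.
Set Implicit Arguments. Unset Strict Implicit. Unset Printing Implicit Defensive.
Import Order.TTheory GRing.Theory Num.Theory.
Local Open Scope ring_scope.

Section CRN.
Variables (R : realFieldType) (S Rx : finType) (Sm Sp : S -> Rx -> nat).

Definition stoich (s : S) (r : Rx) : R := (Sp s r)%:R - (Sm s r)%:R.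

Definition conservation_law (x : S -> R) : Prop :=
  forall r : Rx, \sum_(s : S) x s * stoich s r = 0.

Definition excl_autocatalytic (M : {set S}) (Rs : {set Rx}) : Prop :=
  [/\ M != set0, Rs != set0,
   (exists v : Rx -> R, (forall r, r \in Rs -> 0 < v r) /\
      (forall s, s \in M -> 0 < \sum_(r in Rs) stoich s r * v r)),
   (forall s, s \in M -> exists2 r, r \in Rs & (0 < Sm s r)%N) &
   (forall r, r \in Rs -> exists2 s, s \in M & (0 < Sm s r)%N)].

Definition autocatalytic_core (AC : {set S}) (RA : {set Rx}) : Prop :=
  excl_autocatalytic AC RA /\
  (forall (M : {set S}) (Rs : {set Rx}), M \subset AC -> Rs \subset RA ->
     (M, Rs) <> (AC, RA) -> ~ excl_autocatalytic M Rs).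

Definition MAS_species (RA : {set Rx}) : {set S} :=
  [set s | [exists r in RA, (0 < Sm s r)%N || (0 < Sp s r)%N]].

Definition core_matrix_invertible (AC : {set S}) (RA : {set Rx}) : Prop :=
  #|AC| = #|RA| /\
  (forall v : Rx -> R, (forall c, c \in AC -> \sum_(r in RA) stoich c r * v r = 0) ->
     forall r, r \in RA -> v r = 0).

(* species-productive cone: { Sbar Sbar_C^{-1} u : u >= 0 };
   Sbar_C^{-1} u is the (unique) v on R_A with Sbar_C v = u. *)
Definition species_productive_cone (AC : {set S}) (RA : {set Rx}) (y : S -> R) : Prop :=
  (forall s, s \notin MAS_species RA -> y s = 0) /\
  exists u : S -> R, (forall c, c \in AC -> 0 <= u c) /\
    exists v : Rx -> R,
      (forall c, c \in AC -> \sum_(r in RA) stoich c r * v r = u c) /\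
      (forall s, s \in MAS_species RA -> y s = \sum_(r in RA) stoich s r * v r).

Definition food_set (RA : {set Rx}) : {set S} :=
  [set s in MAS_species RA | [forall r in RA, stoich s r <= 0]].
Definition waste_set (RA : {set Rx}) : {set S} :=
  [set s in MAS_species RA | [forall r in RA, 0 <= stoich s r]].
Definition member_set (RA : {set Rx}) : {set S} :=
  [set s in MAS_species RA |
     [exists r in RA, 0 < stoich s r] && [exists r in RA, stoich s r < 0]].
Definition TMC (AC : {set S}) (RA : {set Rx}) : {set S} := member_set RA :\: AC.

Definition gen (p : S * bool) : S -> R :=
  fun t => if t == p.1 then (if p.2 then 1 else -1) else 0.

Definition BT (AC : {set S}) (RA : {set Rx}) : {set S * bool} :=
  [set p | [|| (p.1 \in food_set RA) && ~~ p.2,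
               (p.1 \in waste_set RA) && p.2,
               p.1 \in TMC AC RA |
               (p.1 \in AC) && p.2]].

Definition in_cone (B : {set S * bool}) (y : S -> R) : Prop :=
  exists lam : S * bool -> R, (forall p, 0 <= lam p) /\
    forall t, y t = \sum_(p in B) lam p * gen p t.

Definition partition_productive_cone (AC : {set S}) (RA : {set Rx}) (y : S -> R) : Prop :=
  in_cone (BT AC RA) y /\
  forall x : S -> R, conservation_law x ->
    \sum_(s in MAS_species RA) x s * y s = 0.

End CRN.

(* Main.v *)
(* Since |S_A| = |A_C| + 1, the MAS has exactly one species z outside its core.
   The cone generated by B_T is spanned by signed basis vectors, so membership
   in it is a sign condition on each coordinate (in_signed_coneP).  Every vector
   Sbar v is orthogonal to all conservation laws (conservation_orthogonal), and
   for x0 this expresses the z-coordinate through the core coordinates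
   (balance_extra_species).  Using the productive flux of the core one shows that
   core species are never food and that z is never waste, so z is food unless
   it is a non-core member.  P(A) is then contained in Q(T) because a
   productive u >= 0 forces y_z <= 0.  Conversely, for y in Q(T) the core
   coordinates of y are >= 0; solving Sbar_C v = y on the core (the square
   invertible core matrix, see injective_square_solvable) gives a v whose image
   agrees with y on A_C, and on z by the orthogonality to x0. *)
Require Import Defs.
From mathcomp Require Import all_boot all_order all_algebra.
From mathcomp Require Import lra.
Set Implicit Arguments. Unset Strict Implicit. Unset Printing Implicit Defensive.
Import Order.TTheory GRing.Theory Num.Theory.
Local Open Scope ring_scope.

Lemma injective_square_solvable (F : fieldType) (I J : finType)
    (A : {set I}) (B : {set J}) (f : I -> J -> F) :
  #|A| = #|B| ->
  (forall v : J -> F, (forall i, i \in A -> \sum_(j in B) f i j * v j = 0) ->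
     forall j, j \in B -> v j = 0) ->
  forall u : I -> F, exists v : J -> F,
    forall i, i \in A -> \sum_(j in B) f i j * v j = u i.
Proof.
move=> cardAB f_inj u.
pose eqn (k : 'I_#|B|) : I := enum_val (cast_ord (esym cardAB) k).
pose var (k : 'I_#|B|) : J := enum_val k.
pose M : 'M[F]_#|B| := \matrix_(k, l) f (eqn k) (var l).
pose vec (w : 'cV[F]_#|B|) (j : J) := \sum_l (if var l == j then w l 0 else 0).
have vecE w l : vec w (var l) = w l 0.
  rewrite /vec (bigD1 l) //= eqxx big1 ?addr0 // => l' /negbTE.
  by rewrite (inj_eq enum_val_inj) => ->.
have sum_vec w i : \sum_(j in B) f i j * vec w j = \sum_l f i (var l) * w l 0.
  by rewrite big_enum_val; apply: eq_bigr => l _; rewrite vecE.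
have eqn_onto i : i \in A -> exists k, eqn k = i.
  move=> iA; exists (cast_ord cardAB (enum_rank_in iA i)).
  by rewrite /eqn cast_ordK enum_rankK_in.
have MwE w k : (M *m w) k 0 = \sum_l f (eqn k) (var l) * w l 0.
  by rewrite mxE; apply: eq_bigr => l _; rewrite mxE.
have M_inj (w : 'cV[F]_#|B|) : M *m w = 0 -> w = 0.
  move=> Mw0; apply/matrixP => l k; rewrite (ord1 k) mxE -vecE.
  apply: f_inj; last exact: enum_valP.
  by move=> i /eqn_onto [k' <-]; rewrite sum_vec -MwE Mw0 mxE.
have M_unit : M \in unitmx.
  rewrite -row_full_unit -cokermx_eq0; apply/eqP/matrixP => k l.
  have /M_inj/matrixP/(_ k 0) : M *m col l (cokermx M) = 0.
    by rewrite colE mulmxA mulmx_coker mul0mx.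
  by rewrite !mxE.
exists (vec (invmx M *m \col_k u (eqn k))) => i /eqn_onto [k <-].
by rewrite sum_vec -MwE mulmxA mulmxV // mul1mx mxE.
Qed.

Section SignedCone.
Variables (R : realFieldType) (S : finType).

Lemma sum_gen (B : {set S * bool}) (lam : S * bool -> R) (t : S) :
  \sum_(p in B) lam p * gen R p t =
  (if (t, true) \in B then lam (t, true) else 0) -
  (if (t, false) \in B then lam (t, false) else 0).
Proof.
have neq : (t, false) != (t, true) by rewrite xpair_eqE negb_and orbT.
rewrite big_mkcond (bigD1 (t, true)) //= (bigD1 (t, false)) //= big1 ?addr0.
  rewrite /gen /= eqxx.
  by case: ((t, true) \in B); case: ((t, false) \in B);
    rewrite ?mulr1 ?mulrN1 ?subr0 ?addr0 ?add0r ?sub0r.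
move=> [s b] /andP [neq_true neq_false]; rewrite /gen /=.
case: eqP => [ts|]; last by rewrite mulr0 if_same.
by subst; case: b neq_true neq_false; rewrite eqxx.
Qed.

Lemma in_signed_coneP (B : {set S * bool}) (y : S -> R) :
  in_cone B y <->
  forall t, (0 < y t -> (t, true) \in B) /\ (y t < 0 -> (t, false) \in B).
Proof.
split.
  move=> [lam [lam_ge0 y_comb]] t; rewrite y_comb sum_gen.
  have := lam_ge0 (t, true); have := lam_ge0 (t, false).
  by case: ((t, true) \in B); case: ((t, false) \in B) => // a b;
    split => // H; exfalso; lra.
move=> signs.
exists (fun p => if p.2 then (if 0 < y p.1 then y p.1 else 0)
                 else (if y p.1 < 0 then - y p.1 else 0)); split.
  by move=> [s []] /=; case: ifP => // h; lra.
move=> t; rewrite sum_gen /=; have [pos neg] := signs t.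
case: (ltgtP (y t) 0) => yt.
- by rewrite (neg yt) if_same add0r opprK.
- by rewrite (pos yt) if_same subr0.
- by rewrite yt !if_same subr0.
Qed.

End SignedCone.

Section MASGeometry.
Variables (R : realFieldType) (S Rx : finType) (Sm Sp : S -> Rx -> nat).
Variables (AC : {set S}) (RA : {set Rx}).

Local Notation SA := (MAS_species Sm Sp RA).
Local Notation stoich := (stoich R Sm Sp).
Local Notation net v s := (\sum_(r in RA) stoich s r * v r).

Lemma stoich_notin_MAS (s : S) (r : Rx) :
  r \in RA -> s \notin SA -> stoich s r = 0.
Proof.
move=> rRA; rewrite inE negb_exists => /forallP /(_ r).
rewrite rRA /= negb_or -!leqNgt !leqn0 => /andP [/eqP Sm0 /eqP Sp0].
by rewrite /Defs.stoich Sm0 Sp0 subrr.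
Qed.

Lemma conservation_orthogonal (x : S -> R) (v : Rx -> R) :
  conservation_law Sm Sp x -> \sum_(s in SA) x s * net v s = 0.
Proof.
move=> xcl; under eq_bigr do rewrite mulr_sumr.
rewrite exchange_big /= big1 // => r rRA.
transitivity (\sum_s x s * stoich s r * v r).
  rewrite big_mkcond; apply: eq_bigr => s _; case: ifP => sSA.
    by rewrite mulrA.
  by rewrite (stoich_notin_MAS rRA (negbT sSA)) mulr0 mul0r.
by rewrite -mulr_suml xcl mul0r.
Qed.

(* The core consumes in R_A, hence its species belong to the MAS. *)
Lemma core_sub_MAS : excl_autocatalytic R Sm Sp AC RA -> AC \subset SA.
Proof.
case=> _ _ _ consumed _; apply/subsetP => c /consumed [r rRA Sm_pos].
by rewrite inE; apply/existsP; exists r; rewrite rRA Sm_pos.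
Qed.

Lemma BT_support (p : S * bool) :
  AC \subset SA -> p \in BT R Sm Sp AC RA -> p.1 \in SA.
Proof.
move=> /subsetP ACSA; rewrite inE.
by case/or4P => [/andP [/setIdP [] //]|/andP [/setIdP [] //]|
                 /setDP [/setIdP [] //]|/andP [/ACSA]].
Qed.

Lemma productive_not_food (w : Rx -> R) (c : S) :
  (forall r, r \in RA -> 0 < w r) -> 0 < net w c -> c \notin food_set R Sm Sp RA.
Proof.
move=> wpos prod; apply/negP => /setIdP [_ /forallP food].
suff : net w c <= 0 by lra.
rewrite -oppr_ge0 -sumrN; apply: sumr_ge0 => r rRA; rewrite -mulNr mulr_ge0 //.
  by rewrite oppr_ge0; have := food r; rewrite rRA.
exact: ltW (wpos r rRA).
Qed.

Section ExtraSpecies.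
Variable z : S.
Hypothesis z_notin_core : z \notin AC.
Hypothesis MAS_split : SA = z |: AC.
Variable x0 : S -> R.
Hypothesis x0_pos : forall s, 0 < x0 s.
Hypothesis x0_law : conservation_law Sm Sp x0.

Lemma z_in_MAS : z \in SA.
Proof. by rewrite MAS_split setU11. Qed.

Lemma core_in_MAS (c : S) : c \in AC -> c \in SA.
Proof. by move=> cAC; rewrite MAS_split setU1r. Qed.

Lemma balance_extra_species (v : Rx -> R) :
  x0 z * net v z + \sum_(c in AC) x0 c * net v c = 0.
Proof.
by rewrite -(big_setU1 _ z_notin_core) /= -MAS_split conservation_orthogonal.
Qed.

Lemma extra_species_consumed (v : Rx -> R) :
  (forall c, c \in AC -> 0 <= net v c) -> net v z <= 0.
Proof.
move=> core_ge0; have balance := balance_extra_species v.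
have core_sum_ge0 : 0 <= \sum_(c in AC) x0 c * net v c.
  by apply: sumr_ge0 => c cAC; apply: mulr_ge0; [exact: ltW | exact: core_ge0].
rewrite leNgt; apply/negP => zpos; have := mulr_gt0 (x0_pos z) zpos; lra.
Qed.

Hypothesis core_excl : excl_autocatalytic R Sm Sp AC RA.

(* The productive flux w of the core strictly consumes z (its core part of the
   balance is positive), so z is not waste. *)
Lemma extra_not_waste : z \notin waste_set R Sm Sp RA.
Proof.
have [/set0Pn [c0 c0AC] _ [w [wpos wprod]] _ _] := core_excl.
apply/negP => /setIdP [_ /forallP waste].
have zprod_ge0 : 0 <= net w z.
  apply: sumr_ge0 => r rRA; apply: mulr_ge0; last exact: ltW (wpos r rRA).
  by have := waste r; rewrite rRA.
have core_pos : 0 < \sum_(c in AC) x0 c * net w c.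
  rewrite (bigD1 c0) //=; apply: ltr_pwDl.
    exact: mulr_gt0 (x0_pos c0) (wprod c0 c0AC).
  apply: sumr_ge0 => c /andP [cAC _].
  by apply: mulr_ge0; apply: ltW; [exact: x0_pos | exact: wprod].
have := balance_extra_species w.
have := mulr_ge0 (ltW (x0_pos z)) zprod_ge0; lra.
Qed.

(* Core species are produced by the core flux, so none is food. *)
Lemma core_not_food (c : S) : c \in AC -> c \notin food_set R Sm Sp RA.
Proof.
have [_ _ [w [wpos wprod]] _ _] := core_excl.
by move=> cAC; apply: productive_not_food (wprod c cAC).
Qed.

(* Being neither waste nor a non-core member, z must be food. *)
Lemma extra_food_or_member :
  z \notin TMC R Sm Sp AC RA -> z \in food_set R Sm Sp RA.
Proof.
move=> notTMC; rewrite inE z_in_MAS /=; apply/forallP => r; apply/implyP => rRA.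
rewrite leNgt; apply/negP => zprod.
have : ~~ [forall r in RA, 0 <= stoich z r].
  by apply/negP => nonneg; move: extra_not_waste; rewrite inE z_in_MAS nonneg.
rewrite negb_forall => /existsP [r']; rewrite negb_imply -ltNge => /andP [r'RA zcons].
move: notTMC; rewrite inE z_notin_core inE z_in_MAS /=; apply/negP; rewrite negbK.
by apply/andP; split; apply/existsP; [exists r | exists r']; apply/andP.
Qed.

Lemma species_cone_sub_partition_cone (y : S -> R) :
  species_productive_cone Sm Sp AC RA y -> partition_productive_cone Sm Sp AC RA y.
Proof.
move=> [y_out [u [u_ge0 [v [v_core y_net]]]]].
have core_ge0 c : c \in AC -> 0 <= net v c by move=> cAC; rewrite v_core ?u_ge0.
split; last first.
  move=> x xcl; rewrite -[RHS](conservation_orthogonal v xcl).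
  by apply: eq_bigr => s sSA; rewrite y_net.
apply/in_signed_coneP => t.
have [tSA|tSA] := boolP (t \in SA); last by rewrite y_out // ltxx.
move: tSA; rewrite MAS_split in_setU1 => /orP [/eqP ->|tAC].
  have [zTMC|zTMC] := boolP (z \in TMC R Sm Sp AC RA).
    by split=> _; rewrite inE /= zTMC !orbT.
  have yz_le0 : y z <= 0 by rewrite y_net ?z_in_MAS ?extra_species_consumed.
  split=> [yz_pos|_]; first by move: yz_le0; rewrite leNgt yz_pos.
  by rewrite inE /= extra_food_or_member.
have yt_ge0 : 0 <= y t by rewrite y_net ?core_ge0 ?core_in_MAS.
split=> [_|yt_neg]; first by rewrite inE /= tAC !orbT.
by move: yt_ge0; rewrite leNgt yt_neg.
Qed.

Hypothesis core_invertible : core_matrix_invertible R Sm Sp AC RA.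

Lemma partition_cone_sub_species_cone (y : S -> R) :
  partition_productive_cone Sm Sp AC RA y -> species_productive_cone Sm Sp AC RA y.
Proof.
move=> [/in_signed_coneP signs y_orth].
have ACSA := core_sub_MAS core_excl.
have y_out s : s \notin SA -> y s = 0.
  move=> sSA; have [pos neg] := signs s.
  case: (ltgtP (y s) 0) => // ys; [move: (neg ys)|move: (pos ys)];
    by move/(BT_support ACSA); rewrite /= (negbTE sSA).
have y_core_ge0 c : c \in AC -> 0 <= y c.
  move=> cAC; rewrite leNgt; apply/negP => /(signs c).2; rewrite inE /=.
  case/or4P => [/andP [cfood _]|/andP [_ //]|/setDP [_ cTMC]|/andP [_ //]].
    by move: cfood; rewrite (negbTE (core_not_food cAC)).
  by rewrite cAC in cTMC.
have [card_eq net_inj] := core_invertible.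
have [v v_core] := injective_square_solvable card_eq net_inj y.
split=> //; exists y; split=> //; exists v; split=> // s.
rewrite MAS_split in_setU1 => /orP [/eqP ->|sAC]; last by rewrite v_core.
have y_balance := y_orth x0 x0_law.
rewrite MAS_split big_setU1 //= in y_balance.
have v_balance := balance_extra_species v.
rewrite (eq_bigr (fun c => x0 c * y c)) in v_balance; last first.
  by move=> c cAC; rewrite v_core.
apply: (mulfI (negbT (gt_eqF (x0_pos z)))); lra.
Qed.

End ExtraSpecies.

Lemma MAS_extra_species :
  AC \subset SA -> #|SA| = #|AC|.+1 -> exists2 z, z \notin AC & SA = z |: AC.
Proof.
move=> ACSA card_SA.
have /cards1P [z extra] : #|SA :\: AC| == 1%N.
  by rewrite cardsD (setIidPr ACSA) card_SA subSnn.
have /setDP [zSA zAC] : z \in SA :\: AC by rewrite extra set11.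
exists z => //; apply/setP => s; rewrite in_setU1.
have [sAC|sAC] := boolP (s \in AC); first by rewrite orbT (subsetP ACSA).
by rewrite orbF -in_set1 -extra in_setD sAC.
Qed.

End MASGeometry.

Theorem mainTheorem10 (R : realFieldType) (S Rx : finType)
    (Sm Sp : S -> Rx -> nat) (AC : {set S}) (RA : {set Rx}) :
  (exists x : S -> R, (forall s, 0 < x s) /\ conservation_law Sm Sp x) ->
  autocatalytic_core R Sm Sp AC RA ->
  (forall M : {set S}, autocatalytic_core R Sm Sp M RA -> M = AC) ->
  core_matrix_invertible R Sm Sp AC RA ->
  #|MAS_species Sm Sp RA| = #|AC|.+1 ->
  forall y : S -> R,
    species_productive_cone Sm Sp AC RA y <-> partition_productive_cone Sm Sp AC RA y.
Proof.
move=> [x0 [x0_pos x0_law]] [core_excl _] _ core_invertible card_SA y.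
have [z zAC MAS_split] := MAS_extra_species (core_sub_MAS core_excl) card_SA.
split.
- exact: (species_cone_sub_partition_cone zAC MAS_split x0_pos x0_law core_excl).
- exact: (partition_cone_sub_species_cone zAC MAS_split x0_pos x0_law core_excl
    core_invertible).
Qed.
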